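(* Let $(X,|\cdot|)$ be a compact metric space. Given $D\in(2,\infty]$, let $\{Y_k\}$ be a sequence of finite $\delta_k$-nets in $X$ such that $\delta_k\searrow0$ as $k\to\infty$. Put $B=\bigcup_k B(k)$ (union over $k\ge2$, with the nets indexed from $k=1$), where $$B(k)=\{(y,y')\in Y_k^2\setminus\Delta:\ |yy'|\le\delta_{k-1}\phi(\delta_{k-1})\},$$ $\phi(t)=2D$ if $D<\infty$, and, if $D=\infty$, $\phi(t)\ge4$ is a function of $t>0$ with $\phi(t)\to\infty$ and $t\phi(t)\searrow0$ as $t\to0$. Then the set $B$ satisfies the conditions: (a) $B$ is symmetric, i.e. $(y,y')\in B\Leftrightarrow(y',y)\in B$; (b) the set $B_t=\{(y,y')\in B:|yy'|\ge t\}$ is finite for each $t>0$. Moreover, $B$ has density $\mathrm{dens}(B)\ge D$ if $D<\infty$, and local density $\mathrm{dens}_{\mathrm{loc}}(B)=\infty$ if $D=\infty$.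
   Context: $|xy|$ is the distance in $X$; $\Delta=\{(x,x):x\in X\}\subset X^2=X\times X$ is the diagonal; for $z=(x,y)\in X^2$ write $|z|=|xy|$; $X^2$ carries the metric $|zz'|=\max\{|xx'|,|yy'|\}$ for $z=(x,y)$, $z'=(x',y')$. A $\delta$-net in $X$ is a subset $Y\subset X$ such that every point of $X$ is at distance $\le\delta$ from some point of $Y$; here $\delta_k>0$. Density of a subset $B\subset X^2$: $\mathrm{dens}(B)=\inf_{z\in X^2\setminus\Delta}\ \sup_{b\in B}|z|/|zb|$ (with $|z|/0=\infty$). Local density: $\mathrm{dens}_{\mathrm{loc}}(B)=\lim_{t\to0}\mathrm{dens}(B,U_t)$, where $\mathrm{dens}(B,U_t)$ is the density of $B$ in the neighborhood $U_t=\{z\in X^2:|z|\le t\}$ of the diagonal, i.e. $\mathrm{dens}(B,U_t)=\inf_{z\in U_t\setminus\Delta}\ \sup_{b\in B}|z|/|zb|$.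
   Formalization: For D<∞ the density bound dens(B)≥D is proved under the added assumption diam X ≤ 2Dδ_1; without it the claim fails, e.g. for two points at distance 1 with δ_1<1/(2D), where B is empty. *)

(* Defs.v *)
From HB Require Import structures.
From mathcomp Require Import all_boot all_order all_algebra.
From mathcomp Require Import all_classical all_reals all_analysis.

Set Implicit Arguments.
Unset Strict Implicit.
Unset Printing Implicit Defensive.

Import Order.TTheory GRing.Theory Num.Theory.
Import numFieldNormedType.Exports.

Local Open Scope classical_set_scope.
Local Open Scope ring_scope.

Section pairs.
Context {R : realType} {X : metricType R}.
Implicit Types (x y : X) (z b : X * X) (A B : set (X * X)).

Definition zlen z : R := mdist z.1 z.2.

Definition zdist z b : R := Num.max (mdist z.1 b.1) (mdist z.2 b.2).

Definition zdiag : set (X * X) := [set z | z.1 = z.2].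

Definition diag_nbhd (t : R) : set (X * X) := [set z | zlen z <= t].

(* In \bar R one has 0^-1 = +oo, hence zlen z / 0 = +oo off the diagonal.
   The supremum over an empty B is -oo here rather than 0; this does not
   affect any comparison of a density with a positive value. *)
Definition dens_in B A : \bar R :=
  ereal_inf [set ereal_sup [set ((zlen z)%:E / (zdist z b)%:E)%E | b in B]
            | z in A `\` zdiag].

Definition dens B : \bar R := dens_in B setT.

Definition dens_loc B : \bar R :=
  lim (dens_in B (diag_nbhd t) @[t --> (0 : R)^'+]).

(* The limit defining dens_loc always exists. *)
Lemma is_cvg_dens_loc B : cvg (dens_in B (diag_nbhd t) @[t --> (0 : R)^'+]).
Proof.
apply: nonincreasing_at_right_is_cvge; near=> e => s t _ _ st.
apply: ereal_inf_le_tmp => _ [z [zs zD] <-]; exists z => //; split => //.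
exact: le_trans st.
Unshelve. all: by end_near. Qed.

Definition is_net (d : R) (Y : set X) : Prop :=
  forall x, exists2 y, Y y & mdist x y <= d.

End pairs.

Section close_pairs.
Context {R : realType} {X : metricType R}.
Variables (Y : nat -> set X) (delta : nat -> R) (phi : R -> R).

(* Used for k >= 2 only. *)
Definition close_pairs_at (k : nat) : set (X * X) :=
  [set z | [/\ Y k z.1, Y k z.2, ~ zdiag z
             & zlen z <= delta k.-1 * phi (delta k.-1)]].

Definition close_pairs : set (X * X) :=
  \bigcup_(k in [set k | (2 <= k)%N]) close_pairs_at k.

End close_pairs.

(* Main.v *)
(* If [y], [y'] are [delta k]-approximations of [x], [x'] from [Y k], then
   [z = (x, x')] and [b = (y, y')] satisfy [|z| / |zb| >= |z| / delta k], and
   [|b|] differs from [|z|] by at most [2 * delta k].  Choosing the least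
   scale [k] with [M * delta k <= |z|] gives ratio at least [M], while
   [|z| < M * delta k.-1] gives [|b| <= (M + 2) * delta k.-1]; so [b] lies in
   [B(k)] as soon as [M + 2 <= phi (delta k.-1)].  For finite [D] one takes
   [M = D], and the scale [k = 2], which has no upper bound on [|z|] coming from
   minimality, is handled by the diameter bound.  For [D = +oo], [M] is
   arbitrary and only small [|z|], hence large [k], matter. *)
Require Import Defs.
From mathcomp Require Import all_boot all_order all_algebra.
From mathcomp Require Import all_classical all_reals all_analysis.
From mathcomp Require Import lra zify.
Import Order.TTheory GRing.Theory Num.Theory.
Import numFieldNormedType.Exports.
Local Open Scope classical_set_scope.
Local Open Scope ring_scope.

Lemma le_ratio (R : realType) (X : metricType R) (M d : R) (z b : X * X) :
  0 < M -> 0 < zlen z -> zdist z b <= d -> M * d <= zlen z ->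
  (M%:E <= (zlen z)%:E / (zdist z b)%:E)%E.
Proof.
move=> M0 z0 zbd Mdz.
have : 0 <= zdist z b by rewrite le_max mdist_ge0.
rewrite le_eqVlt => /predU1P[<-|zb0].
  by rewrite inve0 gt0_muley ?leey// lte_fin.
rewrite inver gt_eqF// -EFinM lee_fin ler_pdivlMr//.
by rewrite (le_trans _ Mdz)// ler_pM2l.
Qed.

Lemma close_pairs_sym (R : realType) (X : metricType R) (Y : nat -> set X)
    (delta : nat -> R) (phi : R -> R) (y y' : X) :
  close_pairs Y delta phi (y, y') -> close_pairs Y delta phi (y', y).
Proof.
move=> [k k2 [/= Yy Yy' yy' le_yy']]; exists k => //; split => //=.
- by move=> /esym.
- by rewrite /zlen metric_sym.
Qed.

(** The length bound defining [close_pairs_at] tends to 0, so only finitely many scales contain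
    pairs of length at least [t], and each lies in the square of a finite net. *)
Lemma finite_close_pairs (R : realType) (X : metricType R) (Y : nat -> set X)
    (delta : nat -> R) (phi : R -> R) (t : R) :
  (forall k, (1 <= k)%N -> finite_set (Y k)) ->
  delta k * phi (delta k) @[k --> \oo] --> (0 : R) -> 0 < t ->
  finite_set [set z | close_pairs Y delta phi z /\ t <= zlen z].
Proof.
move=> Yfin cvg0 t0.
have [N _ Nt] : \forall k \near \oo, delta k * phi (delta k) < t.
  exact: (cvgr_lt _ cvg0).
(* The length bound at scale [k] involves [delta k.-1], so [k > N] is excluded but [k = N] is not.
   The guard is there because [Y 0] may be infinite. *)
apply: (@sub_finite_set _ _ (\bigcup_(k in `I_N.+1)
  (if (1 <= k)%N then Y k `*` Y k else set0))).
  move=> z [[k /= k2 [Y1 Y2 _ le_z]] t_z].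
  exists k => /=; last by rewrite ifT//; lia.
  rewrite ltnS leqNgt; apply/negP => Nk.
  have := Nt k.-1; rewrite /= => /(_ ltac:(lia)).
  by rewrite ltNge (le_trans t_z).
apply: bigcup_finite; first exact: finite_II.
by move=> k _; case: ifP => // k1; apply: finite_setX; exact: Yfin.
Qed.

(** Take the least [k >= K] with [M * delta k <= L]; the last hypothesis rules out [k = K], so
    [k.-1] is still in range and minimality applies to it. *)
Lemma exists_first_scale (R : realType) (delta : nat -> R) (M L : R) (K : nat) :
  delta @ \oo --> (0 : R) -> 0 < L -> L < M * delta K ->
  exists k, [/\ (K < k)%N, M * delta k <= L & L < M * delta k.-1].
Proof.
move=> delta0 L0 LK.
have [N _ NL] : \forall k \near \oo, M * delta k < L.
  by apply: (cvgr_lt (M * 0)); [exact: cvgMl_tmp|rewrite mulr0].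
have exk : exists k, (K <= k)%N && (M * delta k <= L).
  exists (maxn N K); rewrite leq_maxr/= ltW//.
  by apply: NL; rewrite /= leq_maxl.
case: (ex_minnP exk) => k /andP[Kk kL] kmin.
have Kltk : (K < k)%N.
  rewrite ltn_neqAle Kk andbT; apply/eqP => kE.
  by move: kL; rewrite -kE leNgt LK.
exists k; split => //; rewrite ltNge; apply/negP => kL'.
have := kmin k.-1; rewrite kL' andbT => /(_ ltac:(lia)); lia.
Qed.

(** Common core of both density bounds: only the choice of the scale [k] depends on whether [D] is
    finite. *)
Lemma le_dens_in (R : realType) (X : metricType R) (Y : nat -> set X)
    (delta : nat -> R) (phi : R -> R) (A : set (X * X)) (M : R) :
  (forall k, (1 <= k)%N -> 0 < delta k) ->
  (forall k, (1 <= k)%N -> is_net (delta k) (Y k)) -> 2 < M ->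
  (forall z, A z -> 0 < zlen z -> exists k,
    [/\ (2 <= k)%N, M * delta k <= zlen z &
        forall b : X * X, zlen b <= zlen z + 2 * delta k ->
          zlen b <= delta k.-1 * phi (delta k.-1)]) ->
  (M%:E <= dens_in (close_pairs Y delta phi) A)%E.
Proof.
move=> delta_gt0 Y_net M2 scale.
apply: le_ereal_inf_tmp => _ [[x x'] [Az xx'] <-].
have z0 : 0 < zlen (x, x') by rewrite mdist_gt0; apply/eqP.
have [k [k2 Mk close]] := scale _ Az z0.
have dk0 : 0 < delta k by apply: delta_gt0; lia.
have [y Yy xy] := Y_net k ltac:(lia) x.
have [y' Yy' xy'] := Y_net k ltac:(lia) x'.
have zle : zlen (x, x') <= delta k + (mdist y y' + delta k).
  rewrite (le_trans (metric_triangle _ y _))// lerD//.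
  by rewrite (le_trans (metric_triangle _ y' _))// lerD// metric_sym.
have ble : zlen (y, y') <= zlen (x, x') + 2 * delta k.
  rewrite (le_trans (metric_triangle _ x _))// metric_sym/=.
  have := metric_triangle x x' y'; rewrite /zlen/=; lra.
apply: le_trans (ereal_sup_ubound _); last first.
  exists (y, y'); last by [].
  exists k => //; split => //=; last exact: close.
  (* If [y = y'], then [zlen (x, x') <= 2 * delta k < M * delta k], against the choice of [k]. *)
  rewrite /zdiag/= => yy'; move: zle; rewrite yy' mdistxx.
  have : 2 * delta k < M * delta k by rewrite ltr_pM2r.
  by lra.
apply: (le_ratio _ _ _ (delta k)) => //; first by lra.
by rewrite ge_max xy.
Qed.

Theorem proposition2p9 (R : realType) (X : metricType R)
  (cX : compact [set: X])
  (D : \bar R) (D2 : (2%:E < D)%E)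
  (delta : nat -> R) (Y : nat -> set X)
  (delta_gt0 : forall k, (1 <= k)%N -> 0 < delta k)
  (delta_noninc : forall j k, (1 <= j)%N -> (j <= k)%N -> delta k <= delta j)
  (delta_cvg : delta @ \oo --> (0 : R))
  (Y_finite : forall k, (1 <= k)%N -> finite_set (Y k))
  (Y_net : forall k, (1 <= k)%N -> is_net (delta k) (Y k))
  (phi : R -> R)
  (phi_fin : (D < +oo)%E -> forall t, 0 < t -> (phi t)%:E = (2%:E * D)%E)
  (phi_ge4 : D = +oo%E -> forall t, 0 < t -> 4 <= phi t)
  (phi_cvg : D = +oo%E -> phi t @[t --> (0 : R)^'+] --> +oo)
  (phi_mul_mono : D = +oo%E -> exists2 e : R, 0 < e &
     forall s t, 0 < s -> s <= t -> t < e -> s * phi s <= t * phi t)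
  (phi_mul_cvg : D = +oo%E -> t * phi t @[t --> (0 : R)^'+] --> (0 : R)) :
  let B := close_pairs Y delta phi in
  [/\ forall y y', B (y, y') <-> B (y', y),
      forall t, 0 < t -> finite_set [set z | B z /\ t <= zlen z],
      (* Without the bound on the diameter this clause fails: for two points at
         distance 1 and delta 1 < 1 / (2 D) the set B is empty. *)
      (D < +oo)%E ->
        (forall x x' : X, mdist x x' <= delta 1%N * phi (delta 1%N)) ->
        (D <= dens B)%E
    & D = +oo%E -> dens_loc B = +oo%E].
Proof.
move=> B.
have delta_cvgr : delta @ \oo --> (0 : R)^'+.
  (* Starting at [N.+1] skips index 0, where [delta] need not be positive. *)
  move=> P /delta_cvg [N _ NP]; exists N.+1 => // k /= Nk.
  by apply: NP; [rewrite /=; lia|apply: delta_gt0; lia].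
have phi_finE c : D = c%:E -> forall t, 0 < t -> phi t = 2 * c.
  move=> Dc t t0; have := phi_fin _ t t0.
  by rewrite Dc ltry -EFinM => /(_ isT)[].
split.
- by move=> y y'; split; exact: close_pairs_sym.
- move=> t; apply: finite_close_pairs => //.
  case: D D2 phi_mul_cvg phi_finE {phi_fin phi_ge4 phi_cvg phi_mul_mono}
    => [c|_ /(_ erefl) phi_mul_cvg _|//].
  + move=> _ _ /(_ c erefl) phiE.
    have : delta k * (2 * c) @[k --> \oo] --> (0 * (2 * c) : R).
      exact: cvgMr_tmp.
    rewrite mul0r; apply: cvg_trans; apply: near_eq_cvg.
    by exists 1%N => // k k1; rewrite phiE//; exact: delta_gt0.
  + exact: (cvg_comp _ _ delta_cvgr phi_mul_cvg).
- case: D D2 phi_finE {phi_fin phi_ge4 phi_cvg phi_mul_mono phi_mul_cvg}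
    => [c|//|//]; rewrite lte_fin => c2 /(_ c erefl) phiE _ diam.
  apply: le_dens_in => // z _ z0.
  have [z2|z2] := leP (c * delta 2) (zlen z).
    by exists 2%N; split => // b _; exact: diam.
  have [k [k2 ck kc]] := exists_first_scale _ _ _ _ _ delta_cvg z0 z2.
  exists k; split => //; first exact: ltnW.
  have dk1 : delta k <= delta k.-1 by apply: delta_noninc; lia.
  have dk0 : 0 < delta k by apply: delta_gt0; lia.
  (* [zlen z + 2 * delta k <= (c + 2) * delta k.-1 <= 2 * c * delta k.-1], since [c > 2]. *)
  move=> b /le_trans; apply; rewrite phiE; last by lra.
  by nra.
- move=> Doo; apply: cvg_lim => //; apply/cvgeyPge => A.
  (* The 3 secures [2 < M] when [A] is small. *)
  pose M := Num.max A 3.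
  have /cvgryPge/(_ (M + 2)) := cvg_comp _ _ delta_cvgr (phi_cvg Doo).
  move=> [N _ Nphi].
  have dN0 : 0 < delta N.+1 by exact: delta_gt0.
  have M3 : 3 <= M by rewrite le_max lexx orbT.
  have MN0 : 0 < M * delta N.+1 by rewrite mulr_gt0//; lra.
  near=> t.
  (* This forces the first scale of every [z] with [zlen z <= t] beyond [N.+1], where
     [phi (delta k.-1) >= M + 2]. *)
  have tM : t < M * delta N.+1 by near: t; exact: nbhs_right_lt.
  apply: (@le_trans _ _ M%:E); first by rewrite lee_fin le_max lexx.
  apply: le_dens_in => //; first by lra.
  move=> z zt z0.
  have [k [Nk Mk kM]] :=
    exists_first_scale _ _ _ _ _ delta_cvg z0 (le_lt_trans zt tM).
  exists k; split => //; first by lia.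
  have dk1 : delta k <= delta k.-1 by apply: delta_noninc; lia.
  have dk0 : 0 < delta k by apply: delta_gt0; lia.
  have phik : M + 2 <= phi (delta k.-1) by apply: Nphi => /=; lia.
  move=> b /le_trans; apply.
  rewrite (@le_trans _ _ (delta k.-1 * (M + 2)))//; first by lra.
  by rewrite ler_pM2l//; lra.
Unshelve. all: by end_near. Qed.
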